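(* Let $G$ be a $C$-orderable group. If $G$ admits infinitely many $C$-orderings, then it has uncountably many $C$-orderings. Moreover, in that case no $C$-ordering of $G$ is isolated in the space $\mathcal{CO}(G)$ of $C$-orderings of $G$ (i.e. no singleton $\{\preceq\}$ with $\preceq\,\in\mathcal{CO}(G)$ is open in $\mathcal{CO}(G)$).
   Context: A left-ordering on a group $G$ is a total order $\preceq$ on $G$ that is left-invariant ($f\preceq g$ implies $hf\preceq hg$ for all $f,g,h\in G$). An element $g$ is ($\preceq$-)positive if $g\succ id$. A left-ordering $\preceq$ is Conradian (a $C$-ordering) if for all positive $f,g\in G$ there is $n\in\mathbb{N}=\{1,2,\ldots\}$ with $fg^n\succ g$. A group is $C$-orderable if it admits at least one $C$-ordering. The groups may have arbitrary cardinality. The set $\mathcal{LO}(G)$ of all left-orderings on $G$ is endowed with the topology in which a basis of neighborhoods of $\preceq$ is given by the sets of all left-orderings $\preceq'$ coinciding with $\preceq$ on $\{g_1,\ldots,g_k\}$, where $\{g_1,\ldots,g_k\}$ runs over all finite subsets of $G$; equivalently, by the sets $V_{f_1,\ldots,f_k}$ of all left-orderings $\preceq'$ for which all $f_i$ are $\preceq'$-positive, where $\{f_1,\ldots,f_k\}$ runs over all finite sets of $\preceq$-positive elements. The set $\mathcal{CO}(G)\subset\mathcal{LO}(G)$ of all $C$-orderings carries the subspace topology. *)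

(* Defs.v *)
From HB Require Import structures.
From mathcomp Require Import all_boot all_order.
From mathcomp Require Import all_classical topology.

Set Implicit Arguments.
Unset Strict Implicit.
Unset Printing Implicit Defensive.

Local Open Scope classical_set_scope.
Local Open Scope group_scope.

(* [groupType] covers groups of any cardinality. The order is [bool]-valued,
   which loses nothing classically, and two left-orderings are equal exactly
   when they are extensionally equal (see [leftOrdering_ext]). *)
Record leftOrdering (G : groupType) := LeftOrdering {
  lo_le :> rel G;
  lo_refl : reflexive lo_le;
  lo_anti : antisymmetric lo_le;
  lo_trans : transitive lo_le;
  lo_total : total lo_le;
  lo_mul2l : forall h f g : G, lo_le f g -> lo_le (h * f) (h * g)
}.

HB.instance Definition _ (G : groupType) := gen_eqMixin (leftOrdering G).
HB.instance Definition _ (G : groupType) := gen_choiceMixin (leftOrdering G).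

Lemma leftOrdering_ext (G : groupType) (p q : leftOrdering G) :
  p =2 q -> p = q.
Proof.
case: p q => [p p1 p2 p3 p4 p5] [q q1 q2 q3 q4 q5] /= pq.
have {}pq : p = q by apply/funext => x; apply/funext => y; exact: pq.
by subst q; congr LeftOrdering; exact: Prop_irrelevance.
Qed.

Definition lo_lt (G : groupType) (p : leftOrdering G) : rel G :=
  fun f g => (f != g) && p f g.

Definition lo_pos (G : groupType) (p : leftOrdering G) (g : G) : bool :=
  lo_lt p 1 g.

Definition conradian (G : groupType) (p : leftOrdering G) : Prop :=
  forall f g : G, lo_pos p f -> lo_pos p g ->
    exists n : nat, (0 < n)%N /\ lo_lt p g (f * g ^+ n).

Definition CO (G : groupType) : set (leftOrdering G) :=
  [set p | conradian p].
Arguments CO G : clear implicits.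

(* [q] and [p] induce the same order on [A]; the neighbourhoods of [p] are
   generated by these conditions for finite [A]. *)
Definition lo_agree (G : groupType) (A : set G) (p q : leftOrdering G) : Prop :=
  forall f g : G, A f -> A g -> q f g = p f g.

Section LeftOrderingTopology.
Variable G : groupType.

Definition lo_nbhs (p : leftOrdering G) : set_system (leftOrdering G) :=
  filter_from [set A : set G | finite_set A] (fun A => [set q | lo_agree A p q]).

HB.instance Definition _ := hasNbhs.Build (leftOrdering G) lo_nbhs.

Fact lo_nbhs_filter (p : leftOrdering G) : ProperFilter (nbhs p).
Proof.
apply: filter_from_proper; last by move=> A _; exists p.
apply: filter_from_filter; first by exists set0 => /=; exact: finite_set0.
move=> A B finA finB; exists (A `|` B); first by rewrite /= finite_setU.
by move=> q pq; split=> f g Xf Xg; apply: pq; [left|left|right|right].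
Qed.

Fact lo_nbhs_singleton (p : leftOrdering G) (U : set (leftOrdering G)) :
  nbhs p U -> U p.
Proof. by case=> A _; apply. Qed.

Fact lo_nbhs_nbhs (p : leftOrdering G) (U : set (leftOrdering G)) :
  nbhs p U -> nbhs p (nbhs^~ U).
Proof.
case=> A finA AU; exists A => // q pq; exists A => // r qr.
by apply: AU => f g Af Ag; rewrite qr// pq.
Qed.

HB.instance Definition _ := Nbhs_isNbhsTopological.Build (leftOrdering G)
  lo_nbhs_filter lo_nbhs_singleton lo_nbhs_nbhs.

End LeftOrderingTopology.

(* Main.v *)
From HB Require Import structures.
Require Import Defs.
From mathcomp Require Import all_boot all_order.
From mathcomp Require Import all_classical topology.

(** Both claims follow from the fact that a group with an isolated C-ordering
has only finitely many C-orderings.  Indeed a C-ordering may be described by a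
condition on pairs of positive elements ([conradianP]), so that limits of
C-orderings are C-orderings, and the usual category argument shows that a
nonempty space of C-orderings without isolated points is uncountable
([CO_uncountable]).

Let [p] be a C-ordering isolated by the positivity of a finite set [s].  The
convex subgroups of [p] form a chain, and by Conrad's theorem
([conradian_jump_abelian]) the successive quotients of this chain are abelian.
On a convex jump [N <= H] with [H / N] abelian, [p] may be replaced by any
ordering of [H / N] and remains a C-ordering ([conradian_lift]).  Hence the
ordering of [H / N] is isolated as well, by the image of the elements of [s]
that lie in [H] and not in [N].  An abelian group with an isolated ordering has
rank at most one ([isolated_rank1]).  This has three consequences.

- Each jump contains an element of [s], so the convex subgroups of [p] form a
  finite chain.
- The quotients of consecutive convex subgroups have rank one.
- If [N < K < H] are consecutive, then [H / N] is not abelian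
  ([isolated_nonabelian]): it would have rank one, which [K] forbids.

These properties determine the chain.  Let [q] be another C-ordering, and [L] a
convex subgroup of both [p] and [q], with predecessor [C] for [p].  By the
rank-one property [L] is generated, up to roots, by finitely many elements, so
that it also has a predecessor [N'] for [q].  The commutators of [L] lie in [N']
and meet each jump below [C], hence [C <= N'], and [C = N'] because [L / C] has
rank one.  Therefore the convex subgroups of [p] are convex for all C-orderings
([isolated_convex]), and a C-ordering is determined by the signs that it gives
to the elements of [s] ([isolated_sign]): finitely many choices. *)

Set Implicit Arguments.
Unset Strict Implicit.
Unset Printing Implicit Defensive.

Local Open Scope classical_set_scope.

Local Reserved Notation "x <=_ p y"
  (at level 70, p at level 1, y at next level).
Local Reserved Notation "x <_ p y"
  (at level 70, p at level 1, y at next level).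
Local Notation "x <=_ p y" := (lo_le p x y).
Local Notation "x <_ p y" := (lo_lt p x y).

(** * Left-orderings and their positive cones *)

Section LeftOrderings.
Local Open Scope group_scope.
Variable G : groupType.
Implicit Types (p q : leftOrdering G) (x y z f g h : G).

Lemma lo_le_mul2l p h x y : (h * x <=_p h * y) = (x <=_p y).
Proof.
apply/idP/idP => [|/lo_mul2l//].
by move=> /(lo_mul2l h^-1); rewrite !mulKg.
Qed.

Lemma lo_lt_mul2l p h x y : (h * x <_p h * y) = (x <_p y).
Proof. by rewrite /lo_lt lo_le_mul2l (inj_eq (mulgI h)). Qed.

Lemma lo_ltE p x y : (x <_p y) = lo_pos p (x^-1 * y).
Proof. by rewrite /lo_pos -(lo_lt_mul2l p x^-1) mulVg. Qed.

Lemma lo_ltMr p x y : (x <_p x * y) = lo_pos p y.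
Proof. by rewrite -[X in X <_p _]mulg1 lo_lt_mul2l. Qed.

Lemma lo_leMr p x y : (x <=_p x * y) = (1 <=_p y).
Proof. by rewrite -[X in X <=_p _]mulg1 lo_le_mul2l. Qed.

Lemma lo_leE p x y : (x <=_p y) = (x == y) || lo_pos p (x^-1 * y).
Proof. by rewrite -lo_ltE /lo_lt; case: eqVneq => [->|//]; rewrite lo_refl. Qed.

Lemma lo_ltNge p x y : (x <_p y) = ~~ (y <=_p x).
Proof.
rewrite /lo_lt; have [->|xy] := eqVneq x y; first by rewrite lo_refl.
have := lo_total p x y; case xley: (x <=_p y); case ylex: (y <=_p x) => //= _.
by move: xy; rewrite (@lo_anti _ p x y) ?xley ?ylex ?eqxx.
Qed.

Lemma lo_leNgt p x y : (x <=_p y) = ~~ (y <_p x).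
Proof. by rewrite lo_ltNge negbK. Qed.

Lemma lo_ltW p x y : x <_p y -> x <=_p y. Proof. by case/andP. Qed.

Lemma lo_ltxx p x : (x <_p x) = false.
Proof. by rewrite lo_ltNge lo_refl. Qed.

Lemma lo_le_lt_trans p y x z : x <=_p y -> y <_p z -> x <_p z.
Proof.
move=> xy; rewrite !lo_ltNge; apply: contra => zx; exact: lo_trans zx xy.
Qed.

Lemma lo_lt_le_trans p y x z : x <_p y -> y <=_p z -> x <_p z.
Proof.
rewrite !lo_ltNge => xy yz; apply: contra xy => zx; exact: lo_trans yz zx.
Qed.

Lemma lo_lt_trans p y x z : x <_p y -> y <_p z -> x <_p z.
Proof. by move=> /lo_ltW; exact: lo_le_lt_trans. Qed.

Lemma lo_pos1 p : lo_pos p 1 = false. Proof. exact: lo_ltxx. Qed.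

Lemma lo_pos_neq1 p x : lo_pos p x -> x <> 1.
Proof. by move=> + x1; rewrite x1 lo_pos1. Qed.

Lemma lo_posV p x : lo_pos p x^-1 = (x <_p 1).
Proof. by rewrite lo_ltE mulg1. Qed.

Lemma lo_posM p x y : lo_pos p x -> lo_pos p y -> lo_pos p (x * y).
Proof.
move=> xp yp; apply: lo_lt_trans xp _.
by rewrite lo_ltMr.
Qed.

Lemma lo_pos_total p x : x <> 1 -> lo_pos p x \/ lo_pos p x^-1.
Proof.
move=> x1; rewrite lo_posV /lo_pos /lo_lt (eq_sym 1).
have /eqP -> := x1; apply/orP; exact: lo_total.
Qed.

Lemma lo_pos_asym p x : lo_pos p x -> lo_pos p x^-1 -> False.
Proof. by move=> xp /(lo_posM xp); rewrite mulgV lo_pos1. Qed.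

Lemma lo_posX p x n : (0 < n)%N -> lo_pos p x -> lo_pos p (x ^+ n).
Proof.
case: n => // n _ xp; elim: n => // n IH.
by rewrite expgS; exact: lo_posM.
Qed.

Lemma lo_posXE p x n : (0 < n)%N -> lo_pos p (x ^+ n) = lo_pos p x.
Proof.
move=> n0; apply/idP/idP => [xn|]; last exact: lo_posX.
have [|//|xV] := @lo_pos_total p x.
  by move=> x1; rewrite x1 expg1n lo_pos1 in xn.
by case: (@lo_pos_asym p (x ^+ n)) => //; rewrite -expVgn; exact: lo_posX.
Qed.

Lemma lo_torsion_free (p : leftOrdering G) x n :
  (0 < n)%N -> x ^+ n = 1 -> x = 1.
Proof.
move=> n0 xn1; apply: contrapT => /(lo_pos_total p)[] /(lo_posX n0).
  by rewrite xn1 lo_pos1.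
by rewrite expVgn xn1 invg1 lo_pos1.
Qed.

Lemma lo_pos_inj p q : (forall x, lo_pos p x -> lo_pos q x) -> q = p.
Proof.
move=> pq; apply: leftOrdering_ext => x y.
rewrite !lo_leE; case: eqVneq => //= xy; apply/idP/idP; last exact: pq.
have [|//|] := @lo_pos_total p (x^-1 * y).
  by move=> /eqP; rewrite mulg_eq1 (inj_eq invg_inj) (negPf xy).
by move=> /pq + /lo_pos_asym h => /h.
Qed.

Lemma lo_of_cone (P : set G) :
  ~ P 1 -> (forall x y, P x -> P y -> P (x * y)) ->
  (forall x, x <> 1 -> P x \/ P x^-1) ->
  exists p, forall x, lo_pos p x <-> P x.
Proof.
move=> P1 PM Ptot.
pose le x y := `[< x = y \/ P (x^-1 * y) >].
have le_refl : reflexive le by move=> x; apply/asboolP; left.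
have le_anti : antisymmetric le.
  move=> x y /andP[/asboolP[//|Pxy] /asboolP[//|Pyx]].
  by case: P1; have := PM _ _ Pxy Pyx; rewrite mulgA mulgK mulVg.
have le_trans : transitive le.
  move=> y x z /asboolP[->//|Pxy] /asboolP[<-|Pyz]; apply/asboolP; right => //.
  by have := PM _ _ Pxy Pyz; rewrite mulgA mulgK.
have le_total : total le.
  move=> x y; apply/orP; have [->|xy] := EM (x = y).
    by left; apply/asboolP; left.
  have [|xyP|] := Ptot (x^-1 * y).
  - by move=> /eqP; rewrite mulg_eq1 (inj_eq invg_inj) => /eqP.
  - by left; apply/asboolP; right.
  by rewrite invgM invgK; right; apply/asboolP; right.
have le_mul h f g : le f g -> le (h * f) (h * g).
  move=> /asboolP[->//|fg]; apply/asboolP; right.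
  by rewrite invgM -mulgA mulKg.
exists (LeftOrdering le_refl le_anti le_trans le_total le_mul) => x.
rewrite /lo_pos /lo_lt /= /le invg1 mul1g; split.
  by case/andP => /eqP + /asboolP[].
move=> Px; apply/andP; split; first by apply/eqP => x1; rewrite -x1 in Px.
by apply/asboolP; right.
Qed.

(** The Conradian condition holds as soon as it holds with [n = 2]; unlike the
existential condition, this one passes to limits of orderings.  If it fails for
[f] and [g], i.e. [f * g ^+ 2 <= g], then [h := f * g] satisfies [h * g <= g],
hence [h ^+ n < g] for all [n], and then [f * h ^+ n < f * g = h] contradicts
the existential condition. *)
Lemma conradianP p :
  conradian p <->
  (forall f g, lo_pos p f -> lo_pos p g -> lo_pos p (g^-1 * (f * g ^+ 2))).
Proof.
split=> [cp f g fp gp|cp f g fp gp]; last first.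
  by exists 2; split=> //; rewrite lo_ltE; exact: cp.
rewrite -lo_ltE lo_ltNge; apply/negP => fgg.
have hgg : f * g * g <=_p g by rewrite -mulgA.
have hn n : (f * g) ^+ n.+1 * g <=_p g.
  elim: n => // n IH; apply: lo_trans hgg.
  by rewrite expgS -mulgA lo_le_mul2l.
have [[|n] [// _]] := cp f (f * g) fp (lo_posM fp gp).
rewrite lo_lt_mul2l lo_ltNge => /negP; apply; apply: lo_trans (hn n).
by rewrite lo_leMr; exact: lo_ltW.
Qed.

End LeftOrderings.

(** * The space of C-orderings *)

(** Isolation in the space of C-orderings, in terms of the neighbourhoods that
are given by the positivity of finitely many elements. *)
Definition isolating (G : groupType) (p : leftOrdering G) (s : seq G) : Prop :=
  (forall f, f \in s -> lo_pos p f) /\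
  (forall q, CO G q -> (forall f, f \in s -> lo_pos q f) -> q = p).

Section SpaceOfOrderings.
Local Open Scope group_scope.
Variable G : groupType.

Lemma open_singleton_isolating (p : set_type (CO G)) :
  open [set p] -> exists s, isolating (set_val p) s.
Proof.
move=> [B Bopen Bp].
have Bvp : B (set_val p).
  have : (set_val @^-1` B) p by rewrite Bp.
  by [].
have : nbhs (set_val p) B by exact: open_nbhs_nbhs.
move=> [A /finite_seqP[t At] AB].
pose s := [seq x <- [seq a^-1 * b | a <- t, b <- t] | lo_pos (set_val p) x].
exists s; split=> [f|q qC qs]; first by rewrite mem_filter => /andP[].
have Bq : B q.
  apply: AB => f g; rewrite At /= => ft gt.
  have pq u v : u \in t -> v \in t ->
      lo_pos (set_val p) (u^-1 * v) -> lo_pos q (u^-1 * v).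
    move=> ut vt puv; apply: qs; rewrite mem_filter puv /=.
    by apply/allpairsP; exists (u, v).
  rewrite !lo_leE; case: eqVneq => //= fg; apply/idP/idP; last exact: pq.
  have [|//|] := @lo_pos_total _ (set_val p) (f^-1 * g).
    by move=> /eqP; rewrite mulg_eq1 (inj_eq invg_inj) (negPf fg).
  rewrite invgM invgK => /(pq _ _ gt ft) gfp fgp.
  by case: (lo_pos_asym fgp); rewrite invgM invgK.
have : (set_val @^-1` B) (SigSub (mem_set qC)) by [].
by rewrite Bp => <-.
Qed.

(** An ultrafilter limit of a sequence of Conradian orderings: [x] is positive
when it is positive for almost all of them. *)
Lemma CO_limit (q_ : nat -> leftOrdering G) : (forall n, CO G (q_ n)) ->
  exists2 q, CO G q &
    forall x, (exists N, forall n, (N <= n)%N -> lo_pos (q_ n) x) -> lo_pos q x.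
Proof.
move=> qC; have [U [UU sU]] := ultraFilterLemma eventually_filter.
have [] := @lo_of_cone G [set x | U [set n | lo_pos (q_ n) x]].
- rewrite /=; have -> : [set n | lo_pos (q_ n) 1] = set0.
    by apply/seteqP; split=> // n /=; rewrite lo_pos1.
  exact: filter_not_empty.
- move=> x y /= Ux Uy; apply: filterS (filterI Ux Uy) => n [/= xn yn].
  exact: lo_posM.
- move=> x x1; have [|Un] := in_ultra_setVsetC [set n | lo_pos (q_ n) x] UU.
    by left.
  right; apply: filterS Un => n /= xn.
  by have [/xn|] := lo_pos_total (q_ n) x1.
move=> q qE; exists q.
  apply/conradianP => f g /qE /= Uf /qE /= Ug; apply/qE.
  apply: filterS (filterI Uf Ug) => n [/= fn gn].
  by apply: (conradianP _).1 => //; exact: qC.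
move=> x [N xN]; apply/qE; apply: sU; exists N => // n /=; exact: xN.
Qed.

(** Baire category argument: if the orderings were listed as [e 0], [e 1], ...,
then positivity of more and more elements could be imposed on an ordering so
as to make it differ from each [e n], and a limit would be missing. *)
Lemma CO_uncountable : CO G !=set0 ->
  (forall p s, CO G p -> ~ isolating p s) -> ~ countable (CO G).
Proof.
move=> [p0 p0C] noiso cnt.
have [e eP] : exists e : nat -> leftOrdering G,
    forall p, CO G p -> exists n, e n = p.
  move/countable_injP: cnt => [f finj].
  exists (fun n => xget p0 [set p | CO G p /\ f p = n]) => p pC; exists (f p).
  have [|qC fq] := @xgetPex _ p0 [set q | CO G q /\ f q = f p].
    by exists p.
  by apply: finj; rewrite ?inE.
pose T := {s : seq G | exists2 p, CO G p & forall f, f \in s -> lo_pos p f}.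
have step n (s : T) : exists s' : T, {subset sval s <= sval s'} /\
    exists2 x, x \in sval s' & ~~ lo_pos (e n) x.
  case: s => s [p pC ps] /=.
  have [q qC [qs qe]] : exists2 q, CO G q &
      (forall f, f \in s -> lo_pos q f) /\ q <> e n.
    have [pe|] := EM (p = e n); last by exists p.
    apply: contrapT => noq; apply: (noiso p s pC); split=> // q qC qs.
    by apply: contrapT => qp; apply: noq; exists q => //; rewrite -pe.
  have [x qx ex] : exists2 x, lo_pos q x & ~~ lo_pos (e n) x.
    apply: contrapT => nox; apply: qe; apply/esym/lo_pos_inj => x qx.
    by apply: contrapT => /negP ex; apply: nox; exists x.
  have sq : exists2 p, CO G p & forall f, f \in x :: s -> lo_pos p f.
    by exists q => // f; rewrite inE => /orP[/eqP->//|]; exact: qs.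
  exists (exist _ (x :: s) sq) => /=; split.
    by move=> f fs; rewrite inE fs orbT.
  by exists x; rewrite ?inE ?eqxx.
have [nxt nxtP] := choice (fun ns : nat * T => step ns.1 ns.2).
have s0 : exists2 p, CO G p & forall f, f \in [::] -> lo_pos p f.
  by exists p0.
pose S := fix S n : T := if n is k.+1 then nxt (k, S k) else exist _ [::] s0.
have Sle m n : (m <= n)%N -> {subset sval (S m) <= sval (S n)}.
  move=> /subnK <-; elim: (n - m)%N => // k IH f /IH.
  exact: (nxtP (_, _)).1.
have [q_ qP] : exists q_ : nat -> leftOrdering G, forall n,
    CO G (q_ n) /\ forall f, f \in sval (S n) -> lo_pos (q_ n) f.
  have qS n : exists p, CO G p /\ forall f, f \in sval (S n) -> lo_pos p f.
    by have [p] := svalP (S n); exists p.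
  by have [q_ qP] := choice qS; exists q_.
have [q qC qlim] := CO_limit (fun n => (qP n).1).
have [n en] := eP q qC.
have [_ [x xS]] := nxtP (n, S n); rewrite en => /negP; apply; apply: qlim.
by exists n.+1 => m nm; apply: (qP m).2; exact: Sle nm _ xS.
Qed.

End SpaceOfOrderings.

(** * Convex subgroups and quotients *)

(** The group operations of a quotient are only known inside a proof; this
bundle turns them into a [groupType] there. *)
Record group_laws := GroupLaws {
  gl_sort : choiceType;
  gl_one : gl_sort;
  gl_inv : gl_sort -> gl_sort;
  gl_mul : gl_sort -> gl_sort -> gl_sort;
  gl_mulA : associative gl_mul;
  gl_mul1g : left_id gl_one gl_mul;
  gl_mulg1 : right_id gl_one gl_mul;
  gl_mulVg : left_inverse gl_one gl_inv gl_mul;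
  gl_mulgV : right_inverse gl_one gl_inv gl_mul
}.

Definition group_of_laws (L : group_laws) : Type := gl_sort L.

HB.instance Definition _ L := Choice.on (group_of_laws L).
HB.instance Definition _ L := isGroup.Build (group_of_laws L)
  (@gl_mulA L) (@gl_mul1g L) (@gl_mulg1 L) (@gl_mulVg L) (@gl_mulgV L).

Section Subgroups.
Local Open Scope group_scope.
Variable G : groupType.
Implicit Types (p : leftOrdering G) (x y z f g h : G) (C D H M N : set G).

Record is_subgroup H : Prop := IsSubgroup {
  sub1 : H 1;
  subM : forall x y, H x -> H y -> H (x * y);
  subV : forall x, H x -> H x^-1
}.

Definition root_closed H := forall x n, (0 < n)%N -> H (x ^+ n) -> H x.

Lemma subX H x n : is_subgroup H -> H x -> H (x ^+ n).
Proof.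
move=> sH Hx; elim: n => [|n IH]; first exact: sub1.
by rewrite expgS; exact: subM.
Qed.

Lemma subVE H x : is_subgroup H -> H x^-1 <-> H x.
Proof. by move=> sH; split=> /(subV sH); rewrite ?invgK. Qed.

Lemma subMl H x y : is_subgroup H -> H x -> H (x * y) <-> H y.
Proof.
move=> sH Hx; split=> [Hxy|]; last exact: subM.
by rewrite -(mulKg x y); apply: subM => //; exact: subV.
Qed.

Lemma subMr H x y : is_subgroup H -> H y -> H (x * y) <-> H x.
Proof.
move=> sH Hy; split=> [Hxy|Hx]; last exact: subM.
by rewrite -(mulgK y x); apply: subM => //; exact: subV.
Qed.

(** To avoid subtypes, [pi] is a function on all of [G]; it is a morphism on
[H]. *)
Record quotient_map H N (Q : groupType) (pi : G -> Q) : Prop := QuotientMap {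
  quot_sub : is_subgroup H;
  quotM : forall x y, H x -> H y -> pi (x * y) = pi x * pi y;
  quot_eq1 : forall x, H x -> pi x = 1 <-> N x;
  quot_surj : forall a, exists2 x, H x & pi x = a
}.

Section QuotientMap.
Variables (H N : set G) (Q : groupType) (pi : G -> Q).
Hypothesis piq : quotient_map H N pi.
Let sH := quot_sub piq.

Lemma quot_one : pi 1 = 1.
Proof.
have H1 := sub1 sH.
by apply: (mulgI (pi 1)); rewrite -(quotM piq H1 H1) !mulg1.
Qed.

Lemma quotV x : H x -> pi x^-1 = (pi x)^-1.
Proof.
move=> Hx; apply/esym/mulg1_eq; rewrite -(quotM piq Hx (subV sH Hx)).
by rewrite mulgV quot_one.
Qed.

Lemma quotX x n : H x -> pi (x ^+ n) = pi x ^+ n.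
Proof.
move=> Hx; elim: n => [|n IH]; first exact: quot_one.
by rewrite !expgS (quotM piq Hx (subX _ sH Hx)) IH.
Qed.

End QuotientMap.

Lemma quotient_group H N : is_subgroup H -> is_subgroup N -> N `<=` H ->
    (forall x y, N x -> H y -> N (y * x * y^-1)) ->
  exists (Q : groupType) (pi : G -> Q), quotient_map H N pi.
Proof.
move=> sH sN NH nNH.
pose cls x : set G := [set y | N (x^-1 * y)].
have clsP x y : H x -> H y -> cls x = cls y <-> N (x^-1 * y).
  move=> Hx Hy; split=> [xy|Nxy].
    have : cls y y by rewrite /cls /= mulVg; exact: sub1.
    by rewrite -xy.
  apply/seteqP; split=> z /=; rewrite /cls /=.
    by move=> Nxz; rewrite -(subMl _ sN Nxy) mulgA mulgK.
  move=> Nyz; have -> : x^-1 * z = (x^-1 * y) * (y^-1 * z).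
    by rewrite !mulgA mulgK.
  exact: (subM sN Nxy Nyz).
have clsM x x' y y' : H x -> H x' -> H y -> H y' ->
    cls x = cls x' -> cls y = cls y' -> cls (x * y) = cls (x' * y').
  move=> Hx Hx' Hy Hy' /clsP Nx /clsP Ny; apply/clsP; [exact: subM..|].
  have -> : (x * y)^-1 * (x' * y') =
      (y^-1 * (x^-1 * x') * y^-1^-1) * (y^-1 * y').
    by rewrite invgM invgK !mulgA mulgK.
  by apply: subM => //; [apply: nNH; [exact: Nx|exact: subV]|exact: Ny].
pose T := {c : set G | exists2 x, H x & cls x = c}.
have rep_ex (c : T) : exists x, H x /\ cls x = sval c.
  by case: c => c [x Hx xc]; exists x.
have [rep repP] := choice rep_ex.
pose mk x (Hx : H x) : T := exist _ (cls x) (ex_intro2 _ _ x Hx erefl).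
have Teq (c d : T) : sval c = sval d -> c = d.
  case: c d => [c cP] [d dP] /= cd; subst d; congr exist.
  exact: Prop_irrelevance.
have Hrep c := (repP c).1.
have crep c := (repP c).2.
pose mul c d := mk _ (subM sH (Hrep c) (Hrep d)).
pose one := mk _ (sub1 sH).
pose inv c := mk _ (subV sH (Hrep c)).
have repmk x (Hx : H x) : cls (rep (mk x Hx)) = cls x by rewrite crep.
have mulA : associative mul.
  move=> a b c; apply: Teq => /=.
  rewrite (clsM _ (rep a) _ (rep b * rep c)) ?repmk//; try (by apply: subM).
  by rewrite mulgA; apply/esym/clsM; rewrite ?repmk//; apply: subM.
have mul1 : left_id one mul.
  move=> a; apply: Teq => /=; rewrite -crep -[in RHS](mul1g (rep a)).
  by apply: clsM; rewrite ?repmk//; exact: sub1.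
have mulr1 : right_id one mul.
  move=> a; apply: Teq => /=; rewrite -crep -[in RHS](mulg1 (rep a)).
  by apply: clsM; rewrite ?repmk//; exact: sub1.
have mulV : left_inverse one inv mul.
  move=> a; apply: Teq => /=; rewrite -(mulVg (rep a)).
  by apply: clsM; rewrite ?repmk//; exact: subV.
have mulrV : right_inverse one inv mul.
  move=> a; apply: Teq => /=; rewrite -(mulgV (rep a)).
  by apply: clsM; rewrite ?repmk//; exact: subV.
pose Tc : choiceType := HB.pack T (gen_eqMixin T) (gen_choiceMixin T).
pose Q : groupType :=
  group_of_laws (@GroupLaws Tc one inv mul mulA mul1 mulr1 mulV mulrV).
pose pi x : Q := if pselect (H x) is left Hx then mk x Hx else one.
have piE x (Hx : H x) : pi x = mk x Hx.
  by rewrite /pi; case: pselect => // Hx'; exact: Teq.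
exists Q, pi; split=> [//|x y Hx Hy|x Hx|a].
- rewrite (piE _ (subM sH Hx Hy)) !piE; apply: Teq => /=.
  by apply: clsM; rewrite ?repmk.
- rewrite piE; split=> [/(congr1 sval)/= /esym/clsP|Nx].
    by rewrite invg1 mul1g; apply => //; exact: sub1.
  apply: Teq; apply/esym/clsP; rewrite ?invg1 ?mul1g//.
  exact: sub1.
- exists (rep a) => //.
  by rewrite (piE _ (Hrep a)); apply: Teq; rewrite /= crep.
Qed.

Definition convex p C :=
  is_subgroup C /\ forall x y, 1 <=_p x -> x <=_p y -> C y -> C x.

Section Convex.
Variable p : leftOrdering G.

Lemma convex_gt C x h : convex p C -> lo_pos p x -> ~ C x -> C h -> h <_p x.
Proof.
move=> [_ cC] xp Cx Ch; rewrite lo_ltNge; apply/negP => xh.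
by apply: Cx; apply: cC xh Ch; exact: lo_ltW.
Qed.

Lemma convex_posMl C x h : convex p C -> lo_pos p x -> ~ C x -> C h ->
  lo_pos p (h * x).
Proof.
move=> cC xp Cx Ch; rewrite -[h]invgK -lo_ltE.
exact: convex_gt cC xp Cx (subV cC.1 Ch).
Qed.

Lemma convex_posMr C x h : convex p C -> lo_pos p x -> ~ C x -> C h ->
  lo_pos p (x * h).
Proof.
move=> cC xp Cx Ch; have [sC CC] := cC.
have nCxh : ~ C (x * h) by rewrite subMr.
have [|//|] := @lo_pos_total _ p (x * h).
  by move=> xh1; apply: nCxh; rewrite xh1; exact: sub1.
rewrite invgM => pos; case: nCxh; rewrite -subVE// invgM.
apply: CC (lo_ltW pos) _ (subV sC Ch).
rewrite -[X in _ <=_p X]mulg1 lo_le_mul2l; apply: lo_ltW.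
by rewrite -lo_posV invgK.
Qed.

Lemma convex_total C D : convex p C -> convex p D -> C `<=` D \/ D `<=` C.
Proof.
move=> cC cD; have [CD|/existsNP[x /not_implyP[Cx Dx]]] := EM (C `<=` D).
  by left.
right => y Dy; have [sC CC] := cC; have [sD _] := cD.
have [x' [Cx' Dx' x'p]] : exists x', [/\ C x', ~ D x' & lo_pos p x'].
  have [|xp|xp] := @lo_pos_total _ p x.
  - by move=> x1; apply: Dx; rewrite x1; exact: sub1.
  - by exists x.
  - by exists x^-1; split=> //; rewrite subVE.
have [->|y1] := EM (y = 1); first exact: sub1.
have [yp|yp] := lo_pos_total p y1.
  exact: CC (lo_ltW yp) (lo_ltW (convex_gt cD x'p Dx' Dy)) Cx'.
rewrite -subVE//.
exact: CC (lo_ltW yp) (lo_ltW (convex_gt cD x'p Dx' (subV sD Dy))) Cx'.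
Qed.

Lemma convex_root_closed C : convex p C -> root_closed C.
Proof.
move=> [sC CC]; have pos x n : lo_pos p x -> C (x ^+ n.+1) -> C x.
  move=> xp; apply: CC (lo_ltW xp) _.
  rewrite expgS lo_leMr.
  by case: n => [|n]; [exact: lo_refl|apply: lo_ltW; exact: lo_posX].
move=> x [//|n] _ Cxn.
have [->|x1] := EM (x = 1); first exact: sub1.
have [xp|xp] := lo_pos_total p x1; first exact: pos Cxn.
rewrite -subVE//; apply: (pos _ n xp); rewrite expVgn; exact: (subV sC Cxn).
Qed.

Lemma convex1 : convex p [set 1].
Proof.
split; first by split=> // [x y /= -> ->|x /= ->]; rewrite ?mulg1 ?invg1.
move=> x y p1x + y1; rewrite y1 => xp1.
by apply: (@lo_anti _ p); rewrite p1x xp1.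
Qed.

Lemma convexT : convex p setT. Proof. by []. Qed.

End Convex.

Definition hull p g : set G := [set x | forall C, convex p C -> C g -> C x].

(** Convex subgroups form a chain, so this is the largest one that avoids [g],
provided that [g <> 1]. *)
Definition core p g : set G := [set x | ~ hull p x g].

(** Convexity of [N] makes the sign of an element of [H] that is not in [N]
depend on its coset only. *)
Lemma quotient_order p H N (Q : groupType) (pi : G -> Q) :
    quotient_map H N pi -> convex p N ->
  exists o : leftOrdering Q, forall x, H x ->
    lo_pos o (pi x) <-> ~ N x /\ lo_pos p x.
Proof.
move=> piq cN; have sH := quot_sub piq.
have pi_pos u v : H u -> H v -> pi u = pi v -> ~ N u -> lo_pos p u ->
    lo_pos p v.
  move=> Hu Hv uv Nu up; rewrite -(mulVKg u v).
  have Huv := subM sH (subV sH Hu) Hv.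
  apply: (convex_posMr cN) => //; apply/(quot_eq1 piq Huv).
  by rewrite (quotM piq (subV sH Hu) Hv) (quotV piq)// uv mulVg.
have [||a a1|o oE] := @lo_of_cone Q
  [set a | exists u, [/\ H u, ~ N u, lo_pos p u & pi u = a]].
- by move=> [u [Hu Nu up /(quot_eq1 piq Hu)]].
- move=> _ _ [u [Hu Nu up <-]] [v [Hv Nv vp <-]].
  exists (u * v); split; last exact: quotM piq _ _ Hu Hv.
  + exact: (subM sH Hu Hv).
  + move=> Nuv; apply: Nu; apply: (cN.2 _ _ (lo_ltW up) _ Nuv).
    by rewrite lo_leMr; exact: lo_ltW.
  + exact: lo_posM.
- have [u Hu uE] := quot_surj piq a; subst a.
  have Nu : ~ N u by move=> /(quot_eq1 piq Hu).
  have u1 : u <> 1 by move=> u1; apply: Nu; rewrite u1; exact: (sub1 cN.1).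
  have [up|up] := lo_pos_total p u1; [left; exists u|right; exists u^-1] => //.
  split=> //; [exact: (subV sH Hu)|by rewrite (subVE _ cN.1)|].
  exact: (quotV piq).
exists o => x Hx; split=> [/oE[u [Hu Nu up ux]]|[Nx xp]]; last first.
  by apply/oE; exists x.
split; last exact: pi_pos ux Nu up.
by move=> /(quot_eq1 piq Hx); rewrite -ux => /(quot_eq1 piq Hu).
Qed.

Section HullCore.
Variable p : leftOrdering G.

Lemma hull_self g : hull p g g. Proof. by []. Qed.

Lemma hull_convex g : convex p (hull p g).
Proof.
split; first split.
- by move=> C [sC _] _; exact: sub1.
- by move=> x y hx hy C cC Cg; apply: (subM cC.1); [exact: hx|exact: hy].
- by move=> x hx C cC Cg; apply: (subV cC.1); exact: hx.
- by move=> x y x1 xy hy C cC Cg; apply: cC.2 x1 xy _; exact: hy.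
Qed.

Lemma hull_sub C g : convex p C -> C g -> hull p g `<=` C.
Proof. by move=> cC Cg x; apply. Qed.

Lemma core_self g : ~ core p g g. Proof. by apply; exact: hull_self. Qed.

Lemma core_sub C g : convex p C -> ~ C g -> C `<=` core p g.
Proof. by move=> cC Cg x Cx /(_ C cC Cx). Qed.

Lemma core_convex g : g <> 1 -> convex p (core p g).
Proof.
move=> g1; split; first split.
- by move=> /(_ _ (convex1 p) erefl).
- move=> x y hx hy hxy.
  have [hsub|hsub] := convex_total (hull_convex x) (hull_convex y).
    apply: hy; apply: hxy (hull_convex y) _.
    by apply: (subM (hull_convex y).1) => //; exact: hsub.
  apply: hx; apply: hxy (hull_convex x) _.
  by apply: (subM (hull_convex x).1) => //; exact: hsub.
- move=> x hx hxV; apply: hx; apply: hxV (hull_convex x) _.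
  exact: (subV (hull_convex x).1).
- move=> x y x1 xy hy hx; apply: hy; apply: hx (hull_convex y) _.
  exact: (hull_convex y).2 x1 xy (@hull_self y).
Qed.

Lemma core_sub_hull g : core p g `<=` hull p g.
Proof.
move=> x cx; have [hsub|hsub] := convex_total (hull_convex x) (hull_convex g).
  exact: hsub.
by case: cx; apply: hsub.
Qed.

Lemma hull_jump g x : hull p g x -> ~ core p g x -> hull p x = hull p g.
Proof.
move=> hx /contrapT hg; apply/seteqP.
by split; apply: hull_sub => //; exact: hull_convex.
Qed.

End HullCore.
End Subgroups.

(** * Conrad's theorem on jumps *)

Section Archimedean.
Local Open Scope group_scope.
Variable G : groupType.
Implicit Types (p : leftOrdering G) (x y z f g h : G) (C D H M N : set G).

Lemma conj_eq1 x y : y * x * y^-1 = 1 -> x = 1.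
Proof. by move=> /divg1_eq/(canRL (mulKg y)); rewrite mulVg. Qed.

(** Conjugation by [y] can only reverse the sign of [x] if [x] is negligible
with respect to [y]: apply the Conradian condition to [y] and
[y * x ^- n * y^-1]. *)
Lemma conradian_conj_neg p x y n : conradian p -> lo_pos p y ->
  lo_pos p (y * x^-1 * y^-1) -> x ^+ n <_p y.
Proof.
case: n => [|n] // /conradianP cp yp wp.
have : lo_pos p ((y * x^-1 * y^-1) ^+ n.+1) by exact: lo_posX.
have -> : (y * x^-1 * y^-1) ^+ n.+1 = y * (x ^+ n.+1)^-1 * y^-1.
  have := conjXg x^-1 y^-1 n.+1; rewrite !conjgE !invgK !mulgA => <-.
  by rewrite expVgn.
move=> {}/cp /(_ yp).
by rewrite expg2 !mulgA mulgVK mulVg mul1g lo_ltE.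
Qed.

Lemma archimedean_conradian p :
  (forall x y, lo_pos p x -> lo_pos p y -> exists n, y <=_p x ^+ n) ->
  conradian p.
Proof.
move=> arch f g fp gp.
have [fg|fg] := boolP (lo_pos p (f^-1 * g)).
  have [n fgn] := arch _ _ gp fg; exists n.+1; split=> //.
  rewrite -(lo_lt_mul2l _ f^-1) mulKg; apply: lo_le_lt_trans fgn _.
  by rewrite expgSr lo_ltMr.
exists 1%N; split=> //; rewrite expg1.
apply: (@lo_le_lt_trans _ _ f); first by rewrite lo_leNgt lo_ltE.
by rewrite lo_ltMr.
Qed.

(** Hoelder's theorem, without embedding into the reals.  The ordering is
two-sided, because no element is negligible.  Writing [x] and [y] between
consecutive powers of a positive [d] shows that a positive commutator
[c := (y * x)^-1 * (x * y)] is smaller than [d ^+ 2].  Either [c] is the least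
positive element and generates the group, or some positive [d] has
[d ^+ 2 <= c]. *)
Lemma archimedean_abelian p :
  (forall x y, lo_pos p x -> lo_pos p y -> exists n, y <=_p x ^+ n) ->
  forall x y, commute x y.
Proof.
move=> arch; have cp := archimedean_conradian arch.
have conj_pos_pos x y : lo_pos p y -> lo_pos p x -> lo_pos p (y * x * y^-1).
  move=> yp xp; have [n] := arch _ _ xp yp.
  apply: contraTT => nxp; rewrite -lo_ltNge.
  apply: conradian_conj_neg cp yp _.
  have [|/(negP nxp)//|] := @lo_pos_total _ p (y * x * y^-1); last first.
    by rewrite !invgM invgK mulgA.
  by move=> /conj_eq1 x1; rewrite x1 lo_pos1 in xp.
have conj_pos x y : lo_pos p x -> lo_pos p (y * x * y^-1).
  move=> xp; have [->|y1] := EM (y = 1); first by rewrite invg1 mul1g mulg1.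
  have [yp|yp] := lo_pos_total p y1; first exact: conj_pos_pos.
  have [|//|] := @lo_pos_total _ p (y * x * y^-1).
    by move=> /conj_eq1 x1; rewrite x1 lo_pos1 in xp.
  move=> /(conj_pos_pos _ _ yp).
  rewrite !invgM !mulgA !invgK mulVg mul1g mulgVK.
  by move=> /(lo_pos_asym xp).
have le_mul2r c a b : a <=_p b -> a * c <=_p b * c.
  rewrite !lo_leNgt; apply: contra; rewrite !lo_ltE => /(conj_pos _ c).
  by rewrite invgM !mulgA mulgV mul1g mulgK.
have lt_mul a b c d : a <_p b -> c <=_p d -> a * c <_p b * d.
  move=> ab cd; apply: (@lo_le_lt_trans _ _ (a * d)).
    by rewrite lo_le_mul2l.
  move: ab; rewrite !lo_ltNge; apply: contra => /(le_mul2r d^-1).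
  by rewrite !mulgK.
have floor d x : lo_pos p d -> lo_pos p x ->
    exists i, d ^+ i <=_p x /\ x <_p d ^+ i.+1.
  move=> dp xp; have ex : exists n, x <_p d ^+ n.
    have [n xn] := arch _ _ dp xp; exists n.+1; apply: lo_le_lt_trans xn _.
    by rewrite expgSr lo_ltMr.
  case: (ex_minnP ex) => -[|n] xn nmin.
    by have := lo_lt_trans xn xp; rewrite lo_ltxx.
  exists n; split=> //; rewrite lo_leNgt; apply/negP => /nmin.
  by rewrite ltnn.
have small x y d : lo_pos p x -> lo_pos p y -> lo_pos p d ->
    (y * x)^-1 * (x * y) <_p d ^+ 2.
  move=> xp yp dp; have [i [ix xi]] := floor d x dp xp.
  have [j [jy yj]] := floor d y dp yp.
  rewrite -(lo_lt_mul2l _ (y * x)) mulVKg.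
  apply: lo_lt_le_trans (lt_mul _ _ _ _ xi (lo_ltW yj)) _.
  have -> : d ^+ i.+1 * d ^+ j.+1 = d ^+ j * d ^+ i * d ^+ 2.
    by rewrite -!expgnDr; congr (d ^+ _); rewrite addnS addSn addn2 addnC.
  apply: (le_mul2r); apply: lo_trans (le_mul2r _ _ _ jy) _.
  by rewrite lo_le_mul2l.
have nopos x y : lo_pos p x -> lo_pos p y -> ~ lo_pos p ((y * x)^-1 * (x * y)).
  move=> xp yp; set c := _ * (x * y) => cp'.
  have [[d dp dc]|nod] := EM (exists2 d, lo_pos p d & d <_p c).
    have cd : c <_p d ^+ 2 := small x y d xp yp dp.
    have ep : lo_pos p (d^-1 * c) by rewrite -lo_ltE.
    have cep : c <_p (d^-1 * c) ^+ 2 := small x y _ xp yp ep.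
    clearbody c.
    have := cep; rewrite lo_ltNge => /negP; apply.
    rewrite expg2 -[X in _ <=_p X]mul1g mulgA; apply: (le_mul2r).
    rewrite -(lo_le_mul2l _ d) !mulgA mulgV mul1g mulg1.
    by have := le_mul2r d^-1 _ _ (lo_ltW cd); rewrite expg2 mulgK.
  have pw z : lo_pos p z -> exists i, z = c ^+ i.
    move=> zp; have [i [iz zi]] := floor c z cp' zp; exists i.
    apply: contrapT => zc; apply: nod; exists ((c ^+ i)^-1 * z).
      by rewrite -lo_ltE /lo_lt iz andbT eq_sym; exact/eqP.
    by rewrite -(lo_lt_mul2l _ (c ^+ i)) mulVKg -expgSr.
  have [i xi] := pw x xp; have [j yj] := pw y yp.
  move: cp'; rewrite /c xi yj -!expgnDr addnC mulVg.
  by rewrite lo_pos1.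
have comm_pos x y : lo_pos p x -> lo_pos p y -> commute x y.
  move=> xp yp; apply: contrapT => nxy.
  have [|/(nopos _ _ xp yp)//|] := @lo_pos_total _ p ((y * x)^-1 * (x * y)).
    by move=> /eqP; rewrite mulg_eq1 (inj_eq invg_inj) => /eqP yx; apply: nxy.
  by rewrite invgM invgK => /(nopos _ _ yp xp).
have comm_posl x y : lo_pos p x -> commute x y.
  move=> xp; have [->|y1] := EM (y = 1); first exact: commute1.
  have [yp|yp] := lo_pos_total p y1; first exact: comm_pos.
  by rewrite -(invgK y); apply: commuteV; exact: comm_pos.
move=> x y; have [->|x1] := EM (x = 1); first exact/commute_sym/commute1.
have [xp|xp] := lo_pos_total p x1; first exact: comm_posl.
by rewrite -(invgK x); apply/commute_sym/commuteV/commute_sym; exact: comm_posl.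
Qed.

End Archimedean.

Section Jump.
Local Open Scope group_scope.
Variable G : groupType.
Implicit Types (x y z f g h : G) (C D H M N : set G).
Variable p : leftOrdering G.
Hypothesis cp : conradian p.

(** A left-ordering controls products on the left only; here the Conradian
condition bounds a product from bounds on its factors, at the price of doubling
the second exponent.  The condition is used for [x^-1 * g ^+ m] and [g ^+ n]. *)
Lemma conradian_mul_bound g x y m n : lo_pos p g ->
  x <=_p g ^+ m -> y <=_p g ^+ n -> x * y <=_p g ^+ (m + n.*2).
Proof.
move=> gp xm yn.
have upper u : 1 <=_p u -> g ^+ n <=_p u * g ^+ n.*2.
  move=> u1; have [->|n0] := posnP n; first by rewrite expg0 mulg1.
  have [<-|u1'] := EM (1 = u).
    rewrite mul1g -addnn expgnDr lo_leMr.
    by apply: lo_ltW; exact: lo_posX.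
  have up : lo_pos p u by apply/andP; split=> //; exact/eqP.
  apply: lo_ltW; rewrite lo_ltE -addnn expgnDr.
  exact: (conradianP _).1 cp _ _ up (lo_posX n0 gp).
have u1 : 1 <=_p x^-1 * g ^+ m by rewrite -(lo_le_mul2l _ x) mulg1 mulVKg.
rewrite expgnDr -(lo_le_mul2l _ x^-1) mulKg mulgA.
exact: lo_trans yn (upper _ u1).
Qed.

(** By the previous bound, the elements [x] such that [x] and [x^-1] are below
powers of [g] form a convex subgroup. *)
Lemma conradian_hull_bound g x : lo_pos p g -> hull p g x ->
  exists n, x <=_p g ^+ n.
Proof.
move=> gp hx.
suff cvx : convex p [set x | (exists n, x <=_p g ^+ n) /\
    (exists n, x^-1 <=_p g ^+ n)].
  have [] // := hx _ cvx; split; first by exists 1%N; rewrite expg1 lo_refl.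
  exists 0%N; rewrite expg0 -(lo_le_mul2l _ g) mulgV mulg1.
  exact: lo_ltW.
split; first split.
- by split; exists 0%N; rewrite ?invg1 lo_refl.
- move=> a b [[n1 h1] [n2 h2]] [[m1 k1] [m2 k2]].
  split; first by exists (n1 + m1.*2)%N; exact: conradian_mul_bound.
  by rewrite invgM; exists (m2 + n2.*2)%N; exact: conradian_mul_bound.
- by move=> a [h1 h2]; rewrite /= invgK.
- move=> a b a1 ab [[n1 h1] [n2 h2]]; split.
    by exists n1; exact: lo_trans ab h1.
  by exists 0%N; rewrite expg0 -(lo_le_mul2l _ a) mulgV mulg1.
Qed.

(** If [x] lies in the core of [g] and the positive element [y] does not, then
[x ^+ n * y <= y ^+ 3] for all [n], since [x ^+ n <= y].  The powers of a
conjugate of [x] by [y] that is outside of the core would exceed [y ^+ 4], and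
this would contradict that bound. *)
Lemma conradian_core_normal g x y : g <> 1 ->
  core p g x -> hull p g y -> core p g (y * x * y^-1).
Proof.
move=> g1; have cN := core_convex p g1; have cH := hull_convex p g.
have NH := @core_sub_hull _ p g.
have bound u v n : lo_pos p u -> ~ core p g u -> core p g v ->
    v ^+ n * u <_p u ^+ 4.
  move=> up uN vN; apply: (@lo_le_lt_trans _ _ (u ^+ 3)).
    have vu : v ^+ n <=_p u ^+ 1.
      by apply: lo_ltW; exact: (convex_gt cN up uN (subX n cN.1 vN)).
    exact: (@conradian_mul_bound u (v ^+ n) u 1 1 up vu (lo_refl p u)).
  by rewrite (expgSr u 3) lo_ltMr.
have large u z : hull p g u -> hull p g z -> ~ core p g z -> lo_pos p z ->
    lo_pos p u -> exists n, u ^+ 4 <_p z ^+ n.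
  move=> uH zH zN zp up; have [|n un] := @conradian_hull_bound z (u ^+ 5) zp.
    by rewrite (hull_jump zH zN); exact: (subX _ cH.1 uH).
  exists n; apply: lo_lt_le_trans un.
  by rewrite (expgSr u 4) lo_ltMr.
have conjX (u v : G) n : (u * v * u^-1) ^+ n = u * v ^+ n * u^-1.
  by have := conjXg v u^-1 n; rewrite !conjgE !invgK !mulgA => <-.
have core_conj u v : lo_pos p u -> hull p g u -> ~ core p g u -> core p g v ->
    lo_pos p (u * v * u^-1) -> core p g (u * v * u^-1).
  move=> up uH uN vN zp; apply: contrapT => zN.
  have zH : hull p g (u * v * u^-1).
    exact: (subM cH.1 (subM cH.1 uH (NH _ vN)) (subV cH.1 uH)).
  have [n] := large u _ uH zH zN zp up; rewrite conjX lo_ltE => wp.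
  have := (conradianP _).1 cp _ _ wp up.
  have -> : u^-1 * ((u ^+ 4)^-1 * (u * v ^+ n * u^-1) * u ^+ 2) =
      (u ^+ 4)^-1 * (v ^+ n * u).
    rewrite expg2 !mulgA mulgVK; congr (_ * _ * _).
    by rewrite -invgM -expgSr expgS invgM mulgVK.
  by rewrite -lo_ltE => /(lo_lt_trans (bound u v n up uN vN)); rewrite lo_ltxx.
have core_conjV u v : lo_pos p u -> hull p g u -> ~ core p g u -> core p g v ->
    lo_pos p (u^-1 * v * u) -> core p g (u^-1 * v * u).
  move=> up uH uN vN zp; apply: contrapT => zN.
  have zH : hull p g (u^-1 * v * u).
    exact: (subM cH.1 (subM cH.1 (subV cH.1 uH) (NH _ vN)) uH).
  have [n] := large u _ uH zH zN zp up.
  have := conjX u^-1 v n; rewrite invgK => ->.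
  rewrite -(lo_lt_mul2l _ u) -expgS !mulgA mulgV mul1g => un.
  have := lo_lt_trans un (bound u v n up uN vN).
  by rewrite expgSr -[X in _ <_p X]mulg1 lo_lt_mul2l lo_ltNge lo_ltW.
move=> xN yH; have [yN|yN] := EM (core p g y).
  by apply: (subM cN.1); [apply: (subM cN.1)|apply: (subV cN.1)].
have y1 : y <> 1 by move=> y1; apply: yN; rewrite y1; exact: (sub1 cN.1).
have [z1|z1] := EM (y * x * y^-1 = 1); first by rewrite z1; exact: (sub1 cN.1).
have xVN := subV cN.1 xN.
have zV : (y * x * y^-1)^-1 = y * x^-1 * y^-1 by rewrite !invgM invgK mulgA.
have [yp|yp] := lo_pos_total p y1; have [zp|] := lo_pos_total p z1.
- exact: core_conj.
- by rewrite -(subVE _ cN.1) zV => zp; exact: core_conj.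
- have := core_conjV y^-1 x yp; rewrite invgK; apply => //.
    exact: (subV cH.1).
  by rewrite (subVE _ cN.1).
- rewrite -(subVE _ cN.1) zV => zp.
  have := core_conjV y^-1 x^-1 yp; rewrite invgK; apply => //.
    exact: (subV cH.1).
  by rewrite (subVE _ cN.1).
Qed.

(** Conrad's theorem: consecutive convex subgroups of a Conradian ordering have
an archimedean quotient, which is therefore abelian. *)
Theorem conradian_jump_abelian g x y : g <> 1 ->
  hull p g x -> hull p g y -> core p g [~ x, y].
Proof.
move=> g1; have cN := core_convex p g1; have cH := hull_convex p g.
have NH := @core_sub_hull _ p g.
have [Q [pi piq]] := quotient_group cH.1 cN.1 NH
  (fun u v => @conradian_core_normal g u v g1).
have [o oE] := quotient_order piq cN.
have arch a b : lo_pos o a -> lo_pos o b -> exists n, b <=_o a ^+ n.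
  have [u uH <-] := quot_surj piq a; have [v vH <-] := quot_surj piq b.
  move=> /(oE _ uH)[uN up] _.
  have [|n vn] := @conradian_hull_bound u v up.
    by rewrite (hull_jump uH uN).
  have unH := subX n cH.1 uH; have unVH := subV cH.1 unH.
  exists n; rewrite lo_leNgt lo_ltE -(quotX piq)// -(quotV piq)//.
  rewrite -(quotM piq)//; apply/negP => /(oE _ (subM cH.1 unVH vH))[_].
  by rewrite -lo_ltE lo_ltNge vn.
have Qab := archimedean_abelian arch.
move=> xH yH; have xyH := subM cH.1 xH yH; have yxH := subM cH.1 yH xH.
have yxVH := subV cH.1 yxH.
have -> : [~ x, y] = (y * x)^-1 * (x * y).
  by rewrite commgEl conjgE invgM !mulgA.
apply/(quot_eq1 piq (subM cH.1 yxVH xyH)).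
by rewrite (quotM piq)// (quotV piq)// !(quotM piq)// (Qab (pi x)) mulVg.
Qed.

End Jump.

(** * Isolated orderings of abelian groups *)

Section AbelianOrders.
Local Open Scope group_scope.
Variable Q : groupType.
Hypothesis Qab : forall x y : Q, commute x y.
Implicit Types (x y a f g : Q) (X C : set Q) (o : leftOrdering Q).

(** In a torsion-free abelian group, positive cones are the maximal root-closed
semigroups that avoid [1]. *)
Definition root_semigroup C :=
  (forall x y, C x -> C y -> C (x * y)) /\ root_closed C.

Definition cone X : set Q :=
  [set x | forall C, root_semigroup C -> X `<=` C -> C x].

Lemma cone_root_semigroup X : root_semigroup (cone X).
Proof.
split=> [x y Cx Cy C sC XC|x n n0 Cx C sC XC].
  by apply: sC.1; [apply: Cx|apply: Cy].
by apply: sC.2 n0 _; exact: Cx.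
Qed.

Lemma sub_cone X : X `<=` cone X. Proof. by move=> x Xx C _; apply. Qed.

Lemma cone_sub X C : root_semigroup C -> X `<=` C -> cone X `<=` C.
Proof. by move=> sC XC x; apply. Qed.

Lemma coneX X x n : (0 < n)%N -> cone X x -> cone X (x ^+ n).
Proof.
case: n => // n _ Cx; elim: n => // n IH.
by rewrite expgS; apply: (cone_root_semigroup X).1.
Qed.

Lemma lo_pos_root_semigroup o : root_semigroup (lo_pos o).
Proof.
split=> [x y xp yp|x n n0]; first exact: lo_posM.
by rewrite /= lo_posXE.
Qed.

(** In the second alternative [c = 1] stands for an element of the cone, whence
the condition that [a] really occurs. *)
Lemma cone_adjoin X a x : cone (a |` X) x ->
  exists m k c, [/\ (0 < m)%N, x ^+ m = a ^+ k * c &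
    cone X c \/ c = 1 /\ (0 < k)%N].
Proof.
pose D := [set x | exists m k c, [/\ (0 < m)%N, x ^+ m = a ^+ k * c &
    cone X c \/ c = 1 /\ (0 < k)%N]].
move=> Cx; suff : D x by []; apply: Cx.
  split=> [{}x y [m [k [c [m0 xE cP]]]] [m' [k' [c' [m'0 yE c'P]]]]|].
    exists (m * m')%N, (k * m' + k' * m)%N, (c ^+ m' * c' ^+ m); split.
    - by rewrite muln_gt0 m0.
    - rewrite expgMn; last exact: Qab.
      rewrite expgnA xE mulnC expgnA yE !expgMn; try exact: Qab.
      rewrite expgnDr !expgnA !mulgA; congr (_ * _).
      by rewrite -!mulgA; congr (_ * _); exact: Qab.
    - case: cP c'P => [cX|[-> k0]] [c'X|[-> k'0]].
      + by left; apply: (cone_root_semigroup X).1; exact: coneX.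
      + by left; rewrite expg1n mulg1; exact: coneX.
      + by left; rewrite expg1n mul1g; exact: coneX.
      + by right; rewrite !expg1n mulg1 addn_gt0 !muln_gt0 k0 m'0.
  move=> {}x n n0 [m [k [c [m0 xE cP]]]]; exists (n * m)%N, k, c.
  by rewrite muln_gt0 n0 m0 expgnA.
move=> {}x [->|Xx].
  by exists 1%N, 1%N, 1; rewrite mulg1; split=> //; right.
by exists 1%N, 0%N, x; rewrite mul1g; split=> //; left; exact: sub_cone.
Qed.

(** Zorn: in a maximal root-closed semigroup avoiding [1], each [a <> 1] occurs
up to inversion, for otherwise [a] could be adjoined. *)
Lemma cone_extend (u : leftOrdering Q) X : X !=set0 -> ~ cone X 1 ->
  exists o, forall x, X x -> lo_pos o x.
Proof.
move=> [x0 Xx0] X1.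
(* The empty set is admitted because it is the union of the empty chain. *)
pose ok C := [/\ root_semigroup C, ~ C 1 & C = set0 \/ X `<=` C].
have [|C [[sC C1 XC] Cmax]] := @Zorn_bigcup Q ok.
  move=> F Fok Ftot; have Fsg C : F C -> root_semigroup C by move=> /Fok[].
  split; first split.
  - move=> x y [C FC Cx] [D FD Dy]; have [CD|DC] := Ftot _ _ FC FD.
      by exists D => //; apply: (Fsg D FD).1 => //; exact: CD.
    by exists C => //; apply: (Fsg C FC).1 => //; exact: DC.
  - move=> x n n0 [C FC Cx]; exists C => //.
    by apply: (Fsg C FC).2 n0 Cx.
  - by move=> [C FC C1]; have [_ + _] := Fok C FC; exact.
  have [[C FC XC]|noX] := EM (exists2 C, F C & X `<=` C).
    by right => x /XC Cx; exists C.
  left; apply/seteqP; split=> // x [C FC Cx].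
  have [_ _ [C0|XC]] := Fok C FC; first by rewrite C0 in Cx.
  by case: noX; exists C.
have {}XC : X `<=` C.
  case: XC => // C0; case: (Cmax (cone X)); last first.
    by split; [exact: cone_root_semigroup|exact: X1|right; exact: sub_cone].
  rewrite C0; split=> // /(_ x0 (sub_cone Xx0)).
  by [].
have Ctot a : a <> 1 -> C a \/ C a^-1.
  move=> a1; apply: contrapT => /not_orP[Ca CaV].
  have aC : C `<` cone (a |` C).
    split=> [x Cx|/(_ a)]; first by apply: sub_cone; right.
    by move=> h; apply: Ca; apply: h; apply: sub_cone; left.
  apply: (Cmax _ aC); split; first exact: cone_root_semigroup.
    move=> /cone_adjoin[m [k [c [m0]]]]; rewrite expg1n => /esym akc.
    have cE : c = a^-1 ^+ k.
      by rewrite expVgn -[RHS]mulg1 -akc mulKg.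
    case=> [/(cone_sub sC (@subset_refl _ C)) Cc|[c1 k0]].
      case: k {akc} cE => [|k] cE; first by rewrite cE in Cc.
      by apply: CaV; apply: (sC.2 _ k.+1) => //; rewrite -cE.
    by apply: a1; apply: (lo_torsion_free u k0); rewrite -akc c1 mulg1.
  by right => x Xx; apply: sub_cone; right; exact: XC.
have [o oE] := lo_of_cone C1 sC.1 Ctot.
by exists o => x /XC /oE.
Qed.

Section Isolated.
Variables (o : leftOrdering Q) (t : seq Q).
Hypothesis tpos : forall f, f \in t -> lo_pos o f.
Hypothesis tiso : forall o', (forall f, f \in t -> lo_pos o' f) -> o' = o.

(** Were [a] not in the cone of [t], some ordering would make [t] and [a^-1]
positive. *)
Lemma isolated_cone a : lo_pos o a -> cone [set` t] a.
Proof.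
move=> ap; have [|] := EM (cone (a^-1 |` [set` t]) 1); last first.
  move=> /(cone_extend o)[|o' o'P]; first by exists a^-1; left.
  have o'E : o' = o by apply: tiso => f ft; apply: o'P; right.
  by case: (lo_pos_asym ap); rewrite -o'E; apply: o'P; left.
move=> /cone_adjoin[m [k [c [m0]]]]; rewrite expg1n => /esym akc.
have cE : c = a ^+ k.
  by rewrite -[RHS]mulg1 -akc expVgn mulVKg.
have cone_pos := cone_sub (lo_pos_root_semigroup o) tpos.
case=> [Cc|[c1 k0]].
  case: k {akc} cE => [|k] cE.
    by move: Cc; rewrite cE => /cone_pos /=; rewrite lo_pos1.
  by apply: ((cone_root_semigroup _).2 _ k.+1) => //; rewrite -cE.
by have := lo_posX k0 ap; rewrite -cE c1 lo_pos1.
Qed.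

(** The generator [f] is redundant: a relation that expresses the [m]-th power
of [f * g^-1] by [f] and [X] involves [f] to a power less than [m], since
otherwise it would write [1] as a product of positive elements. *)
Lemma cone_drop X f g : (forall x, X x -> lo_pos o x) -> lo_pos o f ->
  X g -> cone (f |` X) (f * g^-1) -> cone X f.
Proof.
move=> Xpos fp Xg /cone_adjoin[m [k [c [m0]]]].
have gp := Xpos g Xg.
rewrite expgMn; last exact: Qab.
rewrite expVgn => /(canRL (mulgVK _)) fE cP.
have cgP : cone X (c * g ^+ m).
  have Cgm := coneX m0 (sub_cone Xg).
  case: cP => [Cc|[-> _]]; last by rewrite mul1g.
  exact: (cone_root_semigroup X).1.
rewrite -mulgA in fE; move: (c * g ^+ m) => e in fE cgP.
have [km|mk] := ltnP k m.
  apply: ((cone_root_semigroup X).2 f (m - k)%N); first by rewrite subn_gt0.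
  have -> : f ^+ (m - k) = e; last by [].
  by rewrite (expgnFr _ (ltnW km)) fE (Qab (f ^+ k)) mulgK.
have epos := cone_sub (lo_pos_root_semigroup o) Xpos cgP.
have : lo_pos o (f ^+ (k - m) * e).
  have [->|n0] := posnP (k - m)%N; first by rewrite mul1g.
  by apply: lo_posM => //; exact: lo_posX.
have -> : f ^+ (k - m) * e = 1; last by rewrite lo_pos1.
by rewrite (expgnFr _ mk) -mulgA (Qab _ e) mulgA -fE mulgV.
Qed.

(** The positive cone is generated by [t] up to roots.  For two generators [f]
and [g], one of [f * g^-1] and [g * f^-1] is nonnegative, so that one of them is
redundant ([cone_drop]).  Thus a single generator suffices. *)
Lemma isolated_rank1 x0 : x0 <> 1 :> Q ->
  exists2 f, f \in t & forall x, lo_pos o x ->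
    exists m k, [/\ (0 < m)%N, (0 < k)%N & x ^+ m = f ^+ k].
Proof.
move=> x01.
have main n (s : seq Q) : size s = n -> {subset s <= t} ->
    (forall x, lo_pos o x -> cone [set` s] x) ->
    exists2 f, f \in t & forall x, lo_pos o x -> cone [set f] x.
  elim: n s => [|n IH] [|f [|g s]]//=.
  - move=> _ _ gen; have [y yp] : exists y, lo_pos o y.
      by have [|] := lo_pos_total o x01; [exists x0|exists x0^-1].
    have [] // := gen y yp set0; first by split=> // ? ? ? /[swap].
  - move=> _ st gen; exists f; first by apply: st; rewrite inE.
    move=> x /gen; apply: cone_sub; first exact: cone_root_semigroup.
    by move=> y /=; rewrite inE => /eqP->; exact: sub_cone.
  move=> [sn] st gen.
  have drop h h' : h \in t ->
      (forall x, x \in [:: f, g & s] -> x = h \/ x \in h' :: s) ->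
      {subset h' :: s <= t} -> cone [set` h' :: s] h ->
      exists2 f, f \in t & forall x, lo_pos o x -> cone [set f] x.
    move=> ht hE h't hC; apply: (IH (h' :: s)) => //.
    move=> x /gen; apply: cone_sub; first exact: cone_root_semigroup.
    by move=> y /= /hE[->//|ys]; exact: sub_cone.
  have ft : f \in t by apply: st; rewrite inE eqxx.
  have gt : g \in t by apply: st; rewrite !inE eqxx orbT.
  have gst : {subset g :: s <= t}.
    by move=> y ys; apply: st; rewrite inE ys orbT.
  have fst : {subset f :: s <= t}.
    move=> y; rewrite inE => /orP[/eqP->//|ys].
    by apply: st; rewrite !inE ys !orbT.
  have dropf : cone [set` g :: s] f -> _ := drop f g ft _ gst.
  have dropg : cone [set` f :: s] g -> _ := drop g f gt _ fst.
  have [fg|fg] := EM (f * g^-1 = 1).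
    apply: dropf; last first.
      by rewrite (divg1_eq fg); apply: sub_cone; rewrite /= inE eqxx.
    by move=> y; rewrite inE => /orP[/eqP|]; [left|right].
  have [fgp|gfp] := lo_pos_total o fg.
    apply: dropf; last first.
      apply: (@cone_drop _ f g) => //=; first by move=> y /= /gst /tpos.
      - exact: tpos.
      - by rewrite inE eqxx.
      - have := gen _ fgp; apply: cone_sub; first exact: cone_root_semigroup.
        move=> y /=; rewrite inE => /orP[/eqP->|ys]; apply: sub_cone.
          by left.
        by right.
    by move=> y; rewrite inE => /orP[/eqP|]; [left|right].
  apply: dropg; last first.
    apply: (@cone_drop _ g f) => //=; first by move=> y /= /fst /tpos.
    - exact: tpos.
    - by rewrite inE eqxx.
    - rewrite invgM invgK in gfp.
      have := gen _ gfp; apply: cone_sub; first exact: cone_root_semigroup.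
      move=> y /=; rewrite !inE => /or3P[/eqP->|/eqP->|ys]; apply: sub_cone.
      + by right; rewrite /= inE eqxx.
      + by left.
      + by right; rewrite /= inE ys orbT.
  move=> y; rewrite !inE => /or3P[/eqP->|/eqP->|ys]; [right|left|right] => //.
    by rewrite eqxx.
  by rewrite ys orbT.
have [f ft fC] := main _ t erefl (fun _ => id) isolated_cone.
exists f => // x /fC fx.
have [|m [k [c [m0 xE [Cc|[c1 k0]]]]]] := @cone_adjoin set0 f x.
- by rewrite setU0.
- have [] // : (set0 : set Q) c.
  by apply: Cc => //; split=> // ? ? ? /[swap].
- by exists m, k; rewrite xE c1 mulg1.
Qed.

End Isolated.
End AbelianOrders.

(** * Changing a C-ordering on a jump *)

Section Replacement.
Local Open Scope group_scope.
Variable G : groupType.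
Implicit Types (p q : leftOrdering G) (x y z f g h : G) (C D H M N : set G).

Definition abelian_mod H N := forall x y, H x -> H y -> N [~ x, y].

Lemma abelian_mod_quotient H N : is_subgroup H -> is_subgroup N -> N `<=` H ->
    abelian_mod H N ->
  exists (Q : groupType) (pi : G -> Q),
    quotient_map H N pi /\ forall a b : Q, commute a b.
Proof.
move=> sH sN NH ab; have nN x y : N x -> H y -> N (y * x * y^-1).
  move=> Nx Hy; have -> : y * x * y^-1 = [~ y^-1, x^-1] * x.
    by rewrite commgEl conjgE !invgK !mulgA mulgVK.
  by apply: (subM sN) => //; apply: ab; apply: (subV sH) => //; exact: NH.
have [Q [pi piq]] := quotient_group sH sN NH nN.
exists Q, pi; split=> // a b.
have [x Hx <-] := quot_surj piq a; have [y Hy <-] := quot_surj piq b.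
rewrite /commute -!(quotM piq)// commgC (quotM piq (subM sH Hy Hx)).
  by rewrite ((quot_eq1 piq _).2 (ab x y Hx Hy)) ?mulg1//; exact/NH/ab.
exact/NH/ab.
Qed.

Section Lift.
Variables (p : leftOrdering G) (H N : set G) (Q : groupType) (pi : G -> Q).
Hypotheses (cp : conradian p) (cH : convex p H) (cN : convex p N).
Hypotheses (NH : N `<=` H) (piq : quotient_map H N pi).
Hypothesis Qab : forall a b : Q, commute a b.
Variable o : leftOrdering Q.
Let sH := cH.1.
Let sN := cN.1.

(* Signs: as for [p] in [N] and outside of [H], as for [o] between them. *)
Let pos x := [\/ N x /\ lo_pos p x, H x /\ lo_pos o (pi x) |
                 ~ H x /\ lo_pos p x].

Let posNH x : ~ H x -> pos x -> lo_pos p x.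
Proof. by move=> Hx [[/NH]|[]|[]]. Qed.

Let posH x : H x -> pos x ->
  N x /\ lo_pos p x \/ lo_pos o (pi x).
Proof. by move=> Hx [[]|[]|[]]; [left|right|]. Qed.

Let piN x : N x -> pi x = 1.
Proof. by move=> Nx; apply/(quot_eq1 piq (NH Nx)). Qed.

Let pos_mul x y : pos x -> pos y -> pos (x * y).
Proof.
move=> px py; have [Hx|Hx] := EM (H x); have [Hy|Hy] := EM (H y).
- have Hxy := subM sH Hx Hy.
  have [[Nx xp]|xo] := posH Hx px; have [[Ny yp]|yo] := posH Hy py.
  + by apply: Or31; split; [exact: (subM sN)|exact: lo_posM].
  + by apply: Or32; rewrite (quotM piq)// piN// mul1g.
  + by apply: Or32; rewrite (quotM piq)// (piN Ny) mulg1.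
  + by apply: Or32; rewrite (quotM piq)//; split=> //; exact: lo_posM.
- apply: Or33; rewrite (subMl _ sH Hx); split=> //.
  exact: (convex_posMl cH (posNH Hy py) Hy Hx).
- apply: Or33; rewrite (subMr _ sH Hy); split=> //.
  exact: (convex_posMr cH (posNH Hx px) Hx Hy).
- have xp := posNH Hx px; have yp := posNH Hy py.
  apply: Or33; split; last exact: lo_posM.
  move=> Hxy; apply: Hx; apply: (cH.2 _ _ (lo_ltW xp) _ Hxy).
  by rewrite lo_leMr; exact: lo_ltW.
Qed.

(** The ordering [p] may be replaced on the jump from [N] to [H] by any
ordering of the abelian quotient. *)
Lemma conradian_lift : exists2 q, conradian q &
  forall x, lo_pos q x <->
    [\/ N x /\ lo_pos p x, H x /\ lo_pos o (pi x) | ~ H x /\ lo_pos p x].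
Proof.
have [||x x1|q qE] := @lo_of_cone G pos.
- case=> [[_]|[_]|[_]]; rewrite ?lo_pos1//.
  by rewrite (quot_one piq) lo_pos1.
- exact: pos_mul.
- have [Hx|Hx] := EM (H x); last first.
    have [xp|xp] := lo_pos_total p x1; [left|right]; apply: Or33 => //.
    by rewrite (subVE _ sH).
  have [Nx|Nx] := EM (N x).
    have [xp|xp] := lo_pos_total p x1; [left|right]; apply: Or31 => //.
    by rewrite (subVE _ sN).
  have pi1 : pi x <> 1 by move=> /(quot_eq1 piq Hx).
  have [xo|xo] := lo_pos_total o pi1; [left|right]; apply: Or32 => //.
  by rewrite (subVE _ sH) (quotV piq).
exists q => // f g /qE pf /qE pg.
have [Hg|Hg] := EM (H g).
  exists 2%N; split=> //; rewrite lo_ltE; apply/qE.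
  have Hgg := subX 2 sH Hg; have HgV := subV sH Hg.
  have [Hf|Hf] := EM (H f); last first.
    have fp := posNH Hf pf; apply: Or33; split.
      by rewrite (subMl _ sH HgV) (subMr _ sH Hgg).
    apply: (convex_posMl cH) => //; last by rewrite (subMr _ sH Hgg).
    exact: (convex_posMr cH).
  have Hfgg := subM sH Hf Hgg; have HgVfgg := subM sH HgV Hfgg.
  have piE : pi (g^-1 * (f * g ^+ 2)) = pi f * pi g.
    rewrite (quotM piq)// (quotM piq)// (quotV piq)// (quotX piq)//.
    by rewrite mulgA (Qab _ (pi f)) -mulgA expg2 mulKg.
  have [[Nf fp]|fo] := posH Hf pf; have [[Ng gp]|go] := posH Hg pg.
  + apply: Or31; split; last exact: (conradianP p).1 cp f g fp gp.
    exact: (subM sN (subV sN Ng) (subM sN Nf (subX 2 sN Ng))).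
  + by apply: Or32; rewrite piE (piN Nf) mul1g.
  + by apply: Or32; rewrite piE (piN Ng) mulg1.
  + by apply: Or32; rewrite piE; split=> //; exact: lo_posM.
have gp := posNH Hg pg.
(* The constants come from [f^-1 * g ^+ 2 <= g ^+ (1 + 2 * 2)]: they ensure that
   [f * g ^+ 6] exceeds [g ^+ 2], hence exceeds [g * h] for every [h] in [H]. *)
exists 6%N; split=> //; rewrite lo_ltE; apply/qE.
have fVg : f^-1 <=_p g ^+ 1.
  rewrite expg1; apply: lo_ltW; have [Hf|Hf] := EM (H f).
    exact: (convex_gt cH gp Hg (subV sH Hf)).
  apply: lo_lt_trans gp; rewrite -lo_posV invgK; exact: posNH.
have big h : H h -> h <_p g^-1 * (f * g ^+ 6).
  move=> Hh; rewrite -(lo_lt_mul2l _ g) mulVKg.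
  apply: (@lo_lt_trans _ _ (g ^+ 2)).
    by rewrite expg2 lo_lt_mul2l; exact: (convex_gt cH).
  rewrite -(lo_lt_mul2l _ f^-1) mulKg.
  apply: lo_le_lt_trans (conradian_mul_bound cp gp fVg (lo_refl p (g ^+ 2))) _.
  by rewrite (expgSr g 5) lo_ltMr.
apply: Or33; split; first by move=> /big; rewrite lo_ltxx.
by apply: big; exact: (sub1 sH).
Qed.

End Lift.

Section IsolatedJump.
Variables (p : leftOrdering G) (s : seq G) (H N : set G).
Hypotheses (cp : conradian p) (ps : isolating p s).
Hypotheses (cH : convex p H) (cN : convex p N).
Hypotheses (NH : N `<=` H) (HNab : abelian_mod H N).

(** Otherwise the ordering of the quotient could be changed without affecting
the signs of the elements of [s]. *)
Lemma isolated_jump_rank1 x0 : H x0 -> ~ N x0 ->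
  exists f, [/\ f \in s, H f, ~ N f &
    forall x, H x -> ~ N x -> lo_pos p x ->
      exists m k, [/\ (0 < m)%N, (0 < k)%N & N (x ^+ m * (f ^+ k)^-1)]].
Proof.
move=> Hx0 Nx0; have sH := cH.1.
have [Q [pi [piq Qab]]] := abelian_mod_quotient sH cN.1 NH HNab.
have [o oE] := quotient_order piq cN.
pose t := [seq pi f | f <- s & `[< H f /\ ~ N f >]].
have tP a : a \in t -> exists f, [/\ f \in s, H f, ~ N f & pi f = a].
  move=> /mapP[f]; rewrite mem_filter => /andP[/asboolP[Hf Nf] fs] ->.
  by exists f.
have tpos a : a \in t -> lo_pos o a.
  by move=> /tP[f [fs Hf Nf <-]]; apply/(oE _ Hf); split=> //; exact: ps.1.
have tiso o' : (forall a, a \in t -> lo_pos o' a) -> o' = o.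
  move=> o't; have [q cq qE] := conradian_lift cp cH cN NH piq Qab o'.
  have qp : q = p.
    apply: ps.2 => // f fs; apply/qE; have fp := ps.1 f fs.
    have [Hf|Hf] := EM (H f); last by apply: Or33.
    have [Nf|Nf] := EM (N f); first by apply: Or31.
    apply: Or32; split=> //; apply: o't; apply: map_f.
    by rewrite mem_filter fs andbT; exact/asboolP.
  apply: lo_pos_inj => a; have [x Hx <-] := quot_surj piq a.
  move=> /(oE _ Hx)[Nx]; rewrite -qp => /qE.
  by case=> [[]|[]|[]].
have pi01 : pi x0 <> 1 by move=> /(quot_eq1 piq Hx0).
have [_ /tP[f [fs Hf Nf <-]] fP] := isolated_rank1 Qab tpos tiso pi01.
exists f; split=> // x Hx Nx xp.
have [|m [k [m0 k0 xf]]] := fP (pi x); first by apply/(oE _ Hx).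
exists m, k; split=> //.
have Hxm := subX m sH Hx; have Hfk := subX k sH Hf; have HfkV := subV sH Hfk.
apply/(quot_eq1 piq (subM sH Hxm HfkV)).
by rewrite (quotM piq)// (quotV piq)// !(quotX piq)// xf mulgV.
Qed.

(** A root-closed subgroup between [N] and [H] is one of the two, as the
quotient has rank one. *)
Lemma isolated_jump_root_closed M c : is_subgroup M -> root_closed M ->
  N `<=` M -> H c -> ~ N c -> M c -> H `<=` M.
Proof.
move=> sM rM NM Hc Nc Mc.
have [f [fs Hf Nf fP]] := isolated_jump_rank1 Hc Nc.
have pos x : H x -> ~ N x -> lo_pos p x -> M f -> M x.
  move=> Hx Nx xp Mf; have [m [k [m0 k0 /NM]]] := fP x Hx Nx xp.
  by rewrite (subMr _ sM (subV sM (subX k sM Mf))); exact: rM.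
have Mf : M f.
  have pos_c x : H x -> ~ N x -> lo_pos p x -> M x -> M f.
    move=> Hx Nx xp Mx; have [m [k [m0 k0 /NM]]] := fP x Hx Nx xp.
    by rewrite (subMl _ sM (subX m sM Mx)) (subVE _ sM); exact: rM.
  have c1 : c <> 1 by move=> c1; apply: Nc; rewrite c1; exact: (sub1 cN.1).
  have [|] := lo_pos_total p c1 => cpos; first exact: (pos_c c).
  apply: (pos_c c^-1) => //; [exact: (subV cH.1)|by rewrite (subVE _ cN.1)|].
  exact: (subV sM).
move=> x Hx; have [Nx|Nx] := EM (N x); first exact: NM.
have x1 : x <> 1 by move=> x1; apply: Nx; rewrite x1; exact: (sub1 cN.1).
have [|] := lo_pos_total p x1 => xp; first exact: pos.
rewrite -(subVE _ sM); apply: pos => //; first exact: (subV cH.1).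
by rewrite (subVE _ cN.1).
Qed.

End IsolatedJump.
End Replacement.

(** * Isolated C-orderings *)

Section IsolatedOrdering.
Local Open Scope group_scope.
Variable G : groupType.
Implicit Types (q : leftOrdering G) (x y z f g h : G) (C D L M : set G).
Variables (p : leftOrdering G) (s : seq G).
Hypotheses (cp : conradian p) (ps : isolating p s).

Lemma isolated_jump_generator x : x <> 1 ->
  exists f, [/\ f \in s, hull p x f, ~ core p x f &
    forall z, hull p x z -> ~ core p x z -> lo_pos p z ->
      exists m k, [/\ (0 < m)%N, (0 < k)%N &
        core p x (z ^+ m * (f ^+ k)^-1)]].
Proof.
move=> x1; apply: (isolated_jump_rank1 cp ps (hull_convex p x)
  (core_convex p x1) (@core_sub_hull _ p x) _ (@hull_self _ p x)) => //.
  by move=> a b; exact: conradian_jump_abelian.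
exact: core_self.
Qed.

(** Each jump contains an element of [s], so these counts measure convex
subgroups from below and from above, and make the convex subgroups of [p] a
finite chain. *)
Let inside C := count (fun f => `[< C f >]) s.
Let outside C := count (fun f => `[< ~ C f >]) s.

Let count_lt (P P' : G -> Prop) f : (forall x, P x -> P' x) ->
  f \in s -> P' f -> ~ P f ->
  (count (fun f => `[< P f >]) s < count (fun f => `[< P' f >]) s)%N.
Proof.
move=> PP'; elim: s => // g t IH; rewrite inE => /orP[/eqP->|ft] P'f Pf /=.
  rewrite (asboolT P'f) (asboolF Pf) add0n add1n ltnS; apply: sub_count.
  by move=> z /asboolP Pz; apply/asboolP; exact: PP'.
rewrite -addnS; apply: leq_add; last exact: IH.
by case: (asboolP (P g)) => // Pg; rewrite asboolT//; exact: PP'.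
Qed.

Let inside_core x z : x <> 1 -> core p x z ->
  (inside (hull p z) < inside (hull p x))%N.
Proof.
move=> x1 zN; have [f [fs fH fN _]] := isolated_jump_generator x1.
have zsub : hull p z `<=` core p x by exact: hull_sub (core_convex p x1) zN.
apply: (@count_lt _ _ f) => // [y /zsub|/zsub//].
exact: core_sub_hull.
Qed.

(** Induction along the finite chain of jumps: once the lower end of a jump lies
in [M], one element of the jump brings the whole jump into [M]. *)
Lemma isolated_fill L M : convex p L -> is_subgroup M -> root_closed M ->
  (forall x, L x -> x <> 1 -> exists c, [/\ M c, hull p x c & ~ core p x c]) ->
  L `<=` M.
Proof.
move=> cL sM rM gen x; move: {2}(inside _).+1 (ltnSn (inside (hull p x))) => n.
elim: n x => // n IH x; rewrite ltnS => xn Lx.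
have [->|x1] := EM (x = 1); first exact: sub1.
have [c [Mc cH cN]] := gen x Lx x1.
apply: (isolated_jump_root_closed cp ps (hull_convex p x) (core_convex p x1)
  (@core_sub_hull _ p x) _ sM rM _ cH cN Mc) => //.
  by move=> a b; exact: conradian_jump_abelian.
move=> z zN; apply: IH.
  exact: leq_trans (inside_core x1 zN) xn.
by apply: (hull_sub cL Lx); exact: core_sub_hull.
Qed.

(** In the finite chain of convex subgroups each proper one has a successor,
the smallest hull of an element of [s] outside of it. *)
Lemma isolated_next C w : convex p C -> ~ C w ->
  exists2 y, y <> 1 & core p y = C.
Proof.
move=> cC Cw.
have escape z : ~ C z -> exists f, [/\ f \in s, hull p z f & ~ C f].
  move=> Cz; have z1 : z <> 1.
    by move=> z1; apply: Cz; rewrite z1; exact: (sub1 cC.1).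
  have [f [fs fH fN _]] := isolated_jump_generator z1; exists f; split=> //.
  move=> Cf; apply: Cz; have := hull_sub cC Cf.
  by rewrite (hull_jump fH fN); apply; exact: hull_self.
pose P n := `[< exists f, [/\ f \in s, ~ C f & inside (hull p f) = n] >].
have exP : exists n, P n.
  have [f [fs _ Cf]] := escape w Cw.
  by exists (inside (hull p f)); apply/asboolP; exists f.
case: (ex_minnP exP) => n /asboolP[f [fs Cf fn]] nmin.
have f1 : f <> 1 by move=> f1; apply: Cf; rewrite f1; exact: sub1 cC.1.
exists f => //; apply/seteqP; split; last exact: core_sub.
move=> z zN; apply: contrapT => Cz; have [f' [f's f'H Cf']] := escape z Cz.
have f'N : core p f f'.
  exact: (hull_sub (core_convex p f1) zN).
have := inside_core f1 f'N; rewrite fn ltnNge => /negP; apply; apply: nmin.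
by apply/asboolP; exists f'.
Qed.

(** Otherwise the quotient over two consecutive jumps would have rank one, but
it has a proper nontrivial convex subgroup. *)
Lemma isolated_nonabelian x y : x <> 1 -> y <> 1 -> core p y = hull p x ->
  exists a b, [/\ hull p y a, hull p y b & ~ core p x [~ a, b]].
Proof.
move=> x1 y1 yx; apply: contrapT => nex.
have ab : abelian_mod (hull p y) (core p x).
  by move=> a b aH bH; apply: contrapT => nab; apply: nex; exists a, b.
have xy : hull p x `<=` hull p y by rewrite -yx; exact: core_sub_hull.
have /(_ y) := isolated_jump_root_closed cp ps (hull_convex p y)
  (core_convex p x1) (subset_trans (@core_sub_hull _ p x) xy) ab
  (hull_convex p x).1 (convex_root_closed (hull_convex p x))
  (@core_sub_hull _ p x) (xy x (@hull_self _ p x)) (@core_self _ p x)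
  (@hull_self _ p x).
by rewrite -yx => h; apply: (@core_self _ p y); apply: h; exact: hull_self.
Qed.

Lemma hull_max q (t : seq G) f0 : f0 \in t ->
  exists2 g, g \in t & forall f, f \in t -> hull q g f.
Proof.
elim: t f0 => // a [|b t] IH f0 _.
  by exists a; rewrite ?inE// => f; rewrite inE => /eqP->; exact: hull_self.
have [|g gt gmax] := IH b; first by rewrite inE eqxx.
have [ga|ag] := convex_total (hull_convex q g) (hull_convex q a).
  exists a; first by rewrite inE eqxx.
  move=> f; rewrite inE => /orP[/eqP->|/gmax]; [exact: hull_self|exact: ga].
exists g; first by rewrite inE gt orbT.
move=> f; rewrite inE => /orP[/eqP->|/gmax//]; apply: ag; exact: hull_self.
Qed.

(** Let [C] be the predecessor of a convex subgroup [L] and let [N'] be the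
subgroup that precedes [L] in the convex chain of [q].  Since [N'] contains the
commutators of [L], and these reach every jump below [C], it contains [C]; the
quotient of [L] by [C] having rank one, the two coincide. *)
Lemma isolated_convex q C : conradian q -> convex p C -> convex q C.
Proof.
move=> cq; move: {2}(outside _).+1 (ltnSn (outside C)) => n.
elim: n C => // n IH C; rewrite ltnS => Cn cC.
have [[w Cw]|CT] := EM (exists w, ~ C w); last first.
  have -> : C = setT; last exact: convexT.
  by apply/seteqP; split=> // x _; apply: contrapT => Cx; apply: CT; exists x.
have [y y1 yC] := isolated_next cC Cw.
pose L := hull p y; have cL : convex p L by exact: hull_convex.
have CL : C `<=` L by rewrite -yC; exact: core_sub_hull.
have Ly : L y by exact: hull_self.
have Cy : ~ C y by rewrite -yC; exact: core_self.
have LCab : abelian_mod L C.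
  by rewrite -yC => a b; exact: conradian_jump_abelian.
have [f0 [f0s Lf0 Cf0 _]] := isolated_jump_generator y1; rewrite yC in Cf0.
have cqL : convex q L.
  apply: IH cL; apply: leq_trans Cn; apply: (@count_lt _ _ f0) => //.
  by move=> x Lx Cx; apply: Lx; exact: CL.
have [|g] := @hull_max q [seq f <- s | `[< L f >]] f0.
  by rewrite mem_filter f0s andbT; exact/asboolP.
rewrite mem_filter => /andP[/asboolP Lg gs] gmax.
have g1 : g <> 1 by exact: lo_pos_neq1 (ps.1 g gs).
have LE : hull q g = L.
  apply/seteqP; split; first exact: hull_sub.
  apply: isolated_fill => //.
  - exact: (hull_convex q g).1.
  - exact: convex_root_closed (hull_convex q g).
  move=> x Lx x1; have [f [fs fH fN _]] := isolated_jump_generator x1.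
  exists f; split=> //; apply: gmax; rewrite mem_filter fs andbT.
  by apply/asboolP; exact: (hull_sub cL Lx).
have cN' := core_convex q g1.
have CN' : C `<=` core q g.
  apply: isolated_fill => //; [exact: cN'.1|exact: convex_root_closed cN'|].
  move=> x Cx x1; have xC : hull p x `<=` C by exact: hull_sub.
  have [|y' y'1 y'x] := @isolated_next (hull p x) w (hull_convex p x).
    by move=> /xC.
  have y'L : hull p y' `<=` L.
    apply: hull_sub => //; apply: contrapT => Ly'; apply: Cy; apply: xC.
    by rewrite -y'x; apply: (core_sub cL Ly').
  have [a [b [ay' by' abx]]] := isolated_nonabelian x1 y'1 y'x.
  exists [~ a, b]; split=> //.
    by apply: conradian_jump_abelian => //; rewrite LE; exact: y'L.
  by rewrite -y'x; exact: conradian_jump_abelian.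
have -> : C = core q g; last exact: cN'.
apply/seteqP; split=> // c N'c; apply: contrapT => Cc.
have Lc : L c by rewrite -LE; exact: core_sub_hull.
apply: (@core_self _ q g).
exact: (isolated_jump_root_closed cp ps cL cC CL LCab cN'.1
  (convex_root_closed cN') CN' Lc Cc N'c).
Qed.

(** A power of [x] is a power of some [f] in [s] up to an element of the core of
[x], which is negligible for every C-ordering. *)
Lemma isolated_sign x : x <> 1 -> lo_pos p x ->
  exists2 f, f \in s & forall q, conradian q -> lo_pos q x = lo_pos q f.
Proof.
move=> x1 xp; have [f [fs fH fN fP]] := isolated_jump_generator x1.
exists f => // q cq; have cN := isolated_convex cq (core_convex p x1).
have [m [k [m0 k0 xf]]] := fP x (@hull_self _ p x) (@core_self _ p x) xp.
rewrite -(lo_posXE q x m0) -(lo_posXE q f k0).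
have fkN : ~ core p x (f ^+ k) by move=> /(convex_root_closed cN k0).
rewrite -[x ^+ m](mulgVK (f ^+ k)).
have [] := @lo_pos_total _ q (f ^+ k).
- by move=> fk1; apply: fkN; rewrite fk1; exact: (sub1 cN.1).
- by move=> fkp; rewrite fkp; exact: (convex_posMl cN).
move=> fkp; apply/idP/idP => [h|/lo_pos_asym /(_ fkp)//].
case: (lo_pos_asym h); rewrite invgM; apply: (convex_posMr cN) => //.
  by rewrite (subVE _ cN.1).
exact: (subV cN.1).
Qed.

Lemma isolated_finite : finite_set (CO G).
Proof.
have inj : {in CO G &, injective (fun q => map_tuple (lo_pos q) (in_tuple s))}.
  move=> q q'; rewrite !inE => cq cq' /(congr1 val) /= /eq_in_map qq'.
  apply: lo_pos_inj => x xq; have x1 := lo_pos_neq1 xq.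
  have [|] := lo_pos_total p x1 => /isolated_sign.
    by move=> /(_ x1)[f fs fE]; rewrite fE// qq'// -fE.
  have xV1 : x^-1 <> 1 by move=> /eqP; rewrite invg_eq1 => /eqP.
  move=> /(_ xV1)[f fs fE].
  have [//|xq'] := lo_pos_total q x1.
  by case: (lo_pos_asym xq); rewrite fE// -qq'// -fE.
by rewrite -(eq_finite_set (inj_card_eq inj)); exact: finite_finset.
Qed.

End IsolatedOrdering.

(** * Groups with infinitely many C-orderings *)

(* [set_type (CO G)] is the subtype of C-orderings with the
   subspace topology induced from [leftOrdering G]. *)
Theorem theoremA (G : groupType) (hC : CO G !=set0)
    (hinf : infinite_set (CO G)) :
  ~ countable (CO G) /\
  forall p : set_type (CO G), ~ open [set p].
Proof.
have noiso p s : CO G p -> ~ isolating p s.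
  by move=> cp ps; exact: hinf (isolated_finite cp ps).
split; first exact: CO_uncountable.
by move=> p /open_singleton_isolating[s]; apply: noiso; exact: set_valP.
Qed.
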